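(* Let $X$ and $Y$ be real Banach spaces. Then the following hold. (1) $F^{ph}(X):=\overline{\operatorname{span}}^{\|\cdot\|}\{\delta_x^{ph}:x\in X\}$, where $\delta_x^{ph}:=\delta_x|_{Lip_0^{ph}(X)}$, is a closed subspace of $Lip_0^{ph}(X)^*$. (2) Analogously to the map $\delta_X:X\to F(X)$, $x\mapsto\delta_x$ (a nonlinear isometry), the map $\delta_X^{ph}:X\to F^{ph}(X)$, $x\mapsto\delta_x^{ph}$, is also a nonlinear isometry, i.e. $\|\delta_x^{ph}-\delta_y^{ph}\|=\|x-y\|$ for all $x,y\in X$. (3) The map $\delta_X^{ph}$ is positively homogeneous, unlike the map $\delta_X$ itself. (4) The map $\langle\cdot,\cdot\rangle:Lip_0^{ph}(X)\times F^{ph}(X)\to\mathbb{R}$ given by $\langle f,\mu\rangle:=\mu(f)$ is bilinear and non-degenerate. Moreover, $\sup_{f\in B_{Lip_0^{ph}(X)}}|\mu(f)|=\|\mu\|$ for all $\mu\in F^{ph}(X)$ and $\sup_{\mu\in B_{F^{ph}(X)}}|\mu(f)|=Lip(f)$ for all $f\in Lip_0^{ph}(X)$. (5) $Lip_0^{ph}(X,Y)$ is linearly isometrically isomorphic to $L(F^{ph}(X),Y)$ via the map $f\mapsto T_f$, where $f$ and $T_f:F^{ph}(X)\to Y$ satisfy $T_f\circ\delta_X^{ph}=f$. (6) If $f\in Lip_0^{ph}(X,Y)$, then there exists a unique linear map $C_f:F^{ph}(X)\to F^{ph}(Y)$ such that $C_f\circ\delta_X^{ph}=\delta_Y^{ph}\circ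 f$.
   Context: $Lip_0(X,Y)$ is the Banach space of all Lipschitz maps $f:X\to Y$ with $f(0)=0$, with norm $Lip(f)=\sup_{x\neq w}\frac{\|f(x)-f(w)\|}{\|x-w\|}$, and $Lip_0(X)=Lip_0(X,\mathbb{R})$. $Lip_0^{ph}(X,Y)=\{f\in Lip_0(X,Y): f(\alpha x)=\alpha f(x)\ \forall \alpha\ge 0,\ x\in X\}$ with the same norm, and $Lip_0^{ph}(X)=Lip_0^{ph}(X,\mathbb{R})$. For $x\in X$, $\delta_x\in Lip_0(X)^*$ is the evaluation functional $\delta_x(f)=f(x)$. The Lipschitz-free space $F(X)$ is the norm-closed linear span of $\{\delta_x:x\in X\}$ in $Lip_0(X)^*$. A map $h$ on $X$ is positively homogeneous if $h(\alpha x)=\alpha h(x)$ for all $\alpha\ge0$, $x\in X$. $B_E$ is the closed unit ball of a normed space $E$, and $L(E,Y)$ is the Banach space of bounded linear operators from $E$ to $Y$ with the operator norm.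
   Formalization: In (6), C_f is the unique bounded linear map; among all linear maps uniqueness fails (e.g. X = Y = R^2, f = id, where the span of the δ_x^ph is not closed). In (2) and (3), ''nonlinear'' and ''unlike δ_X'' are asserted for X ≠ {0}, since they fail for X = {0}. *)

(* Defs.v *)
From HB Require Import structures.
From mathcomp Require Import all_boot all_order all_algebra.
From mathcomp Require Import all_classical all_reals ereal topology normedtype.

Set Implicit Arguments.
Unset Strict Implicit.
Unset Printing Implicit Defensive.

Import Order.TTheory GRing.Theory Num.Theory.
Import numFieldNormedType.Exports.

Local Open Scope classical_set_scope.
Local Open Scope ring_scope.

Definition pos_homogeneous (R : realType) (V W : lmodType R) (h : V -> W) :=
  forall (a : R) (x : V), 0 <= a -> h (a *: x) = a *: h x.

Definition unit_ball (R : realType) (E : normedModType R) : set E :=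
  [set x | `|x| <= 1].

Lemma sup_of_ge0 (R : realType) (S : set R) :
  (forall x, S x -> 0 <= x) -> 0 <= sup S.
Proof.
move=> S0; have [hS|hS] := pselect (has_sup S); last by rewrite sup_out.
have [[x Sx] _] := hS.
by apply: le_trans (S0 x Sx) _; exact: sup_upper_bound.
Qed.

Section Lip0.
Context (R : realType) (X Y : normedModType R).

(* If X is trivial the set of pairs is empty, and sup set0 = 0 in the library. *)
Definition lip_norm (f : X -> Y) : R :=
  sup [set `|f p.1 - f p.2| / `|p.1 - p.2| | p in [set p : X * X | p.1 != p.2]].

Definition is_lip0 : {pred X -> Y} := mem [set f | lipschitz f /\ f 0 = 0].

Lemma lipschitz_bound (f : X -> Y) :
  lipschitz f <-> exists M, forall x y, `|f x - f y| <= M * `|x - y|.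
Proof.
rewrite /lipschitz_on; split=> [/pinfty_ex_gt0[M _ fM]|[M fM]].
  by exists M => x y; exact: (fM (x, y)).
exists `|M|; split=> [|N MN [x y] _ /=]; first exact: num_real.
apply: le_trans (fM x y) _; rewrite ler_wpM2r// ltW//.
exact: le_lt_trans (ler_norm M) MN.
Qed.

Lemma is_lip0P (f : X -> Y) : reflect
  ((exists M, forall x y, `|f x - f y| <= M * `|x - y|) /\ f 0 = 0)
  (f \in is_lip0).
Proof.
apply: (iffP idP); rewrite inE /= => -[fM f0]; split=> //.
  by rewrite -lipschitz_bound.
by rewrite lipschitz_bound.
Qed.

Lemma is_lip0_submod_closed : submod_closed is_lip0.
Proof.
split.
  by apply/is_lip0P; split=> //; exists 0 => x y; rewrite subrr normr0 mul0r.
move=> a f g /is_lip0P[[M fM] f0] /is_lip0P[[N gN] g0].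
apply/is_lip0P; split; last by rewrite !fctE f0 g0 scaler0 addr0.
exists (`|a| * M + N) => x y; rewrite !fctE opprD addrACA -scalerBr.
rewrite (le_trans (ler_normD _ _))// mulrDl lerD// normrZ -mulrA.
by rewrite ler_wpM2l.
Qed.

HB.instance Definition _ :=
  GRing.isSubmodClosed.Build R (X -> Y) is_lip0 is_lip0_submod_closed.

Record Lip0 := MkLip0 { Lip0_fun :> X -> Y ; _ : Lip0_fun \in is_lip0 }.

HB.instance Definition _ := [isSub for Lip0_fun].
HB.instance Definition _ := [Choice of Lip0 by <:].
HB.instance Definition _ := [SubChoice_isSubLmodule of Lip0 by <:].

Lemma has_sup_lip (f : X -> Y) (x0 y0 : X) : x0 != y0 -> f \in is_lip0 ->
  has_sup [set `|f p.1 - f p.2| / `|p.1 - p.2| | p in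
           [set p : X * X | p.1 != p.2]].
Proof.
move=> xy0 /is_lip0P[[M fM] _]; split.
  by exists (`|f x0 - f y0| / `|x0 - y0|), (x0, y0).
exists M => _ [[x y] /= xy <-].
by rewrite ler_pdivrMr// normr_gt0 subr_eq0.
Qed.

Lemma lip_norm_le (f : Lip0) x y : `|f x - f y| <= lip_norm f * `|x - y|.
Proof.
have [->|xy] := eqVneq x y; first by rewrite !subrr !normr0 mulr0.
rewrite -ler_pdivrMr ?normr_gt0 ?subr_eq0//.
apply: sup_upper_bound; first exact: has_sup_lip xy (valP f).
by exists (x, y).
Qed.

Lemma lip_norm_ub (f : X -> Y) M : 0 <= M ->
  (forall x y, `|f x - f y| <= M * `|x - y|) -> lip_norm f <= M.
Proof.
move=> M0 fM; rewrite /lip_norm; set S := [set _ | _ in _].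
have [->|/set0P S0] := eqVneq S set0; first by rewrite sup0.
apply: ge_sup => // _ [[x y] /= xy <-].
by rewrite ler_pdivrMr// normr_gt0 subr_eq0.
Qed.

Lemma lip_norm_ge0 (f : X -> Y) : 0 <= lip_norm f.
Proof. by apply: sup_of_ge0 => _ [p _ <-]; rewrite divr_ge0. Qed.

Lemma lip_normD (f g : Lip0) :
  lip_norm (f + g : Lip0) <= lip_norm f + lip_norm g.
Proof.
apply: lip_norm_ub => [|x y]; first by rewrite addr_ge0 ?lip_norm_ge0.
rewrite /= !fctE opprD addrACA (le_trans (ler_normD _ _))// mulrDl.
by rewrite lerD ?lip_norm_le.
Qed.

Lemma lip_normZ (a : R) (f : Lip0) :
  lip_norm (a *: f : Lip0) = `|a| * lip_norm f.
Proof.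
have le b (g : Lip0) : lip_norm (b *: g : Lip0) <= `|b| * lip_norm g.
  apply: lip_norm_ub => [|x y]; first by rewrite mulr_ge0 ?lip_norm_ge0.
  by rewrite /= !fctE -scalerBr normrZ -mulrA ler_wpM2l ?lip_norm_le.
apply/eqP; rewrite eq_le le /=.
have [->|a0] := eqVneq a 0; first by rewrite normr0 mul0r lip_norm_ge0.
have := le a^-1 (a *: f); rewrite scalerA mulVf// scale1r normfV.
by rewrite ler_pdivlMl ?normr_gt0.
Qed.

Lemma lip_norm0_eq0 (f : Lip0) : lip_norm f = 0 -> f = 0.
Proof.
move=> f0; apply/val_inj/funext => x /=.
have /is_lip0P[_ fz] := valP f.
apply/eqP; rewrite -normr_le0 -[f x]subr0 -{1}fz.
by rewrite (le_trans (lip_norm_le _ _ _))// f0 mul0r.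
Qed.

HB.instance Definition _ := @Lmodule_isNormed.Build R Lip0
  (fun f => lip_norm f) lip_normD lip_normZ lip_norm0_eq0.

Definition is_ph : {pred Lip0} := mem [set f : Lip0 | pos_homogeneous f].

Lemma is_ph_submod_closed : submod_closed is_ph.
Proof.
split; first by rewrite inE => a x _ /=; rewrite scaler0.
move=> c f g; rewrite !inE => fP gP a x a0 /=.
by rewrite !fctE fP// gP// scalerDr !scalerA mulrC.
Qed.

HB.instance Definition _ :=
  GRing.isSubmodClosed.Build R Lip0 is_ph is_ph_submod_closed.

Record Lip0ph := MkLip0ph { Lip0ph_val :> Lip0 ; _ : Lip0ph_val \in is_ph }.

HB.instance Definition _ := [isSub for Lip0ph_val].
HB.instance Definition _ := [Choice of Lip0ph by <:].
HB.instance Definition _ := [SubChoice_isSubLmodule of Lip0ph by <:].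

Lemma Lip0ph_normD (f g : Lip0ph) :
  lip_norm (f + g : Lip0ph) <= lip_norm f + lip_norm g.
Proof. exact: lip_normD. Qed.

Lemma Lip0ph_normZ (a : R) (f : Lip0ph) :
  lip_norm (a *: f : Lip0ph) = `|a| * lip_norm f.
Proof. exact: lip_normZ. Qed.

Lemma Lip0ph_norm0_eq0 (f : Lip0ph) : lip_norm f = 0 -> f = 0.
Proof. by move=> /lip_norm0_eq0 f0; exact/val_inj. Qed.

HB.instance Definition _ := @Lmodule_isNormed.Build R Lip0ph
  (fun f => lip_norm f) Lip0ph_normD Lip0ph_normZ Lip0ph_norm0_eq0.

End Lip0.

Section BoundedLinear.
Context (R : realType) (E Y : normedModType R).

Definition op_norm (T : E -> Y) : R := sup [set `|T x| | x in @unit_ball R E].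

(* For linear T, boundedness near 0 means |T x| <= M |x| for some M. *)
Definition is_blin : {pred E -> Y} :=
  mem [set T : E -> Y | linear T /\ bounded_near T (nbhs (0 : E))].

Lemma is_blinP (T : E -> Y) : reflect
  (linear T /\ exists M, forall x, `|T x| <= M * `|x|) (T \in is_blin).
Proof.
apply: (iffP idP); rewrite inE /= => -[lT bT]; split=> //.
  pose T' : {linear E -> Y} := HB.pack T (GRing.isLinear.Build _ _ _ _ T lT).
  have /linear_boundedP/pinfty_ex_gt0[M _ TM] : bounded_near T' (nbhs 0) by [].
  by exists M.
pose T' : {linear E -> Y} := HB.pack T (GRing.isLinear.Build _ _ _ _ T lT).
suff : bounded_near T' (nbhs 0) by [].
apply/linear_boundedP; case: bT => M TM.
exists `|M|; split=> [|N MN x]; first exact: num_real.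
apply: le_trans (TM x) _; rewrite ler_wpM2r// ltW//.
exact: le_lt_trans (ler_norm M) MN.
Qed.

Lemma is_blin_submod_closed : submod_closed is_blin.
Proof.
split.
  apply/is_blinP; split=> [a x y|]; first by rewrite scaler0 addr0.
  by exists 0 => x; rewrite normr0 mul0r.
move=> a S T /is_blinP[lS [M SM]] /is_blinP[lT [N TN]].
apply/is_blinP; split=> [b x y|].
  by rewrite !fctE lS lT !scalerDr !scalerA addrACA (mulrC a).
exists (`|a| * M + N) => x; rewrite !fctE.
rewrite (le_trans (ler_normD _ _))// mulrDl lerD// normrZ -mulrA.
by rewrite ler_wpM2l.
Qed.

HB.instance Definition _ :=
  GRing.isSubmodClosed.Build R (E -> Y) is_blin is_blin_submod_closed.

Record blin := MkBlin { blin_fun :> E -> Y ; _ : blin_fun \in is_blin }.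

HB.instance Definition _ := [isSub for blin_fun].
HB.instance Definition _ := [Choice of blin by <:].
HB.instance Definition _ := [SubChoice_isSubLmodule of blin by <:].

Lemma blin_linear (T : blin) : linear T.
Proof. by have /is_blinP[] := valP T. Qed.

HB.instance Definition _ (T : blin) :=
  GRing.isLinear.Build R E Y *:%R (blin_fun T) (blin_linear T).

Lemma has_sup_blin (T : blin) : has_sup [set `|T x| | x in @unit_ball R E].
Proof.
have /is_blinP[_ [M TM]] := valP T; split.
  by exists `|T 0|, 0 => //; rewrite /unit_ball /= normr0.
exists `|M| => _ [x /= x1 <-]; rewrite (le_trans (TM x))//.
rewrite (le_trans (ler_wpM2r _ (ler_norm M)))//.
by rewrite -[leRHS]mulr1 ler_wpM2l.
Qed.

Lemma op_norm_le (T : blin) x : `|T x| <= op_norm T * `|x|.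
Proof.
have [->|x0] := eqVneq x 0; first by rewrite linear0 !normr0 mulr0.
rewrite -ler_pdivrMr ?normr_gt0// mulrC.
have -> : `|x|^-1 * `|T x| = `|T (`|x|^-1 *: x)|.
  by rewrite linearZ normrZ ger0_norm ?invr_ge0.
apply: sup_upper_bound; first exact: has_sup_blin.
exists (`|x|^-1 *: x) => //; rewrite /unit_ball /= normrZ.
by rewrite ger0_norm ?invr_ge0// mulVf ?normr_eq0.
Qed.

Lemma op_norm_ub (T : E -> Y) M : 0 <= M ->
  (forall x, `|T x| <= M * `|x|) -> op_norm T <= M.
Proof.
move=> M0 TM; apply: ge_sup => [|_ [x /= x1 <-]].
  by exists `|T 0|, 0 => //; rewrite /unit_ball /= normr0.
by rewrite (le_trans (TM x))// -[leRHS]mulr1 ler_wpM2l.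
Qed.

Lemma op_norm_ge0 (T : E -> Y) : 0 <= op_norm T.
Proof. by apply: sup_of_ge0 => _ [x _ <-]. Qed.

Lemma op_normD (S T : blin) : op_norm (S + T : blin) <= op_norm S + op_norm T.
Proof.
apply: op_norm_ub => [|x]; first by rewrite addr_ge0 ?op_norm_ge0.
rewrite /= !fctE (le_trans (ler_normD _ _))// mulrDl.
by rewrite lerD ?op_norm_le.
Qed.

Lemma op_normZ (a : R) (T : blin) : op_norm (a *: T : blin) = `|a| * op_norm T.
Proof.
have le b (S : blin) : op_norm (b *: S : blin) <= `|b| * op_norm S.
  apply: op_norm_ub => [|x]; first by rewrite mulr_ge0 ?op_norm_ge0.
  by rewrite /= !fctE normrZ -mulrA ler_wpM2l ?op_norm_le.
apply/eqP; rewrite eq_le le /=.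
have [->|a0] := eqVneq a 0; first by rewrite normr0 mul0r op_norm_ge0.
have := le a^-1 (a *: T); rewrite scalerA mulVf// scale1r normfV.
by rewrite ler_pdivlMl ?normr_gt0.
Qed.

Lemma op_norm0_eq0 (T : blin) : op_norm T = 0 -> T = 0.
Proof.
move=> T0; apply/val_inj/funext => x /=.
by apply/eqP; rewrite -normr_le0 (le_trans (op_norm_le _ _))// T0 mul0r.
Qed.

HB.instance Definition _ := @Lmodule_isNormed.Build R blin
  (fun T => op_norm T) op_normD op_normZ op_norm0_eq0.

End BoundedLinear.

Definition dual (R : realType) (E : normedModType R) := blin E R.

Section ClosedSpan.
Context (R : realType) (V : normedModType R).

Definition lin_span (A : set V) : set V :=
  [set v | exists s : seq (R * V),
     (forall p, p \in s -> A p.2) /\ v = \sum_(p <- s) p.1 *: p.2].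

Definition closed_span (A : set V) : set V := closure (lin_span A).

Definition in_closed_span (A : set V) : {pred V} := mem (closed_span A).

Lemma lin_span_lin (A : set V) a u v :
  lin_span A u -> lin_span A v -> lin_span A (a *: u + v).
Proof.
move=> [s [sA ->]] [t [tA ->]].
exists ([seq (a * p.1, p.2) | p <- s] ++ t); split=> [p|].
  rewrite mem_cat => /orP[/mapP[q qs ->]|]; [exact: sA qs|exact: tA].
rewrite big_cat big_map scaler_sumr; congr (_ + _).
by apply: eq_bigr => p _; rewrite scalerA.
Qed.

Lemma lin_span0 (A : set V) : lin_span A 0.
Proof. by exists [::]; split=> //; rewrite big_nil. Qed.

Lemma sub_closed_span (A : set V) : A `<=` closed_span A.
Proof.
move=> v Av; apply: subset_closure; exists [:: (1, v)]; split.
  by move=> p; rewrite inE => /eqP ->.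
by rewrite big_seq1 scale1r.
Qed.

Lemma closed_spanP (A : set V) v : closed_span A v <->
  forall e : R, 0 < e -> exists2 u, lin_span A u & `|v - u| < e.
Proof.
split=> [vA e e0|vA B /nbhs_normP[e /= e0 eB]].
  have [] := vA (ball_ Num.norm v e); first by apply/nbhs_normP; exists e.
  by move=> u [Au /= uv]; exists u.
by have [u Au uv] := vA e e0; exists u; split=> //; exact: eB.
Qed.

Lemma in_closed_span_submod_closed (A : set V) :
  submod_closed (in_closed_span A).
Proof.
split; first by rewrite inE; apply: subset_closure; exact: lin_span0.
move=> a u v; rewrite !inE => /closed_spanP uA /closed_spanP vA.
apply/closed_spanP => e e0.
have e20 : 0 < e / 2 by rewrite divr_gt0.
have a1 : 0 < `|a| + 1 by rewrite ltr_wpDl.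
have [u' Au' uu'] := uA (e / 2 / (`|a| + 1)) (divr_gt0 e20 a1).
have [v' Av' vv'] := vA (e / 2) e20.
exists (a *: u' + v'); first exact: lin_span_lin.
rewrite opprD addrACA -scalerBr (le_lt_trans (ler_normD _ _))//.
rewrite [ltRHS](splitr e) ler_ltD// normrZ.
rewrite ltr_pdivlMr// in uu'; apply: le_trans (ltW uu').
by rewrite mulrC ler_wpM2l// lerDl.
Qed.

HB.instance Definition _ (A : set V) :=
  GRing.isSubmodClosed.Build R V (in_closed_span A)
    (in_closed_span_submod_closed A).

Record ClosedSpan (A : set V) := MkClosedSpan {
  ClosedSpan_val : V ; _ : ClosedSpan_val \in in_closed_span A }.

Context (A : set V).

HB.instance Definition _ := [isSub for @ClosedSpan_val A].
HB.instance Definition _ := [Choice of ClosedSpan A by <:].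
HB.instance Definition _ := [SubChoice_isSubLmodule of ClosedSpan A by <:].

Lemma ClosedSpan_val_linear : linear (@ClosedSpan_val A).
Proof. by []. Qed.

HB.instance Definition _ := GRing.isLinear.Build R (ClosedSpan A) V *:%R
  (@ClosedSpan_val A) ClosedSpan_val_linear.

Lemma ClosedSpan_normD (u v : ClosedSpan A) :
  `|val (u + v)| <= `|val u| + `|val v|.
Proof. exact: ler_normD. Qed.

Lemma ClosedSpan_normZ (a : R) (u : ClosedSpan A) :
  `|val (a *: u)| = `|a| * `|val u|.
Proof. exact: normrZ. Qed.

Lemma ClosedSpan_norm0_eq0 (u : ClosedSpan A) : `|val u| = 0 -> u = 0.
Proof. by move=> /normr0_eq0 u0; exact/val_inj. Qed.

HB.instance Definition _ := @Lmodule_isNormed.Build R (ClosedSpan A)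
  (fun u => `|val u|) ClosedSpan_normD ClosedSpan_normZ ClosedSpan_norm0_eq0.

End ClosedSpan.

Section Free.
Context (R : realType) (X : normedModType R).

Lemma eval_blin (x : X) : (fun f : Lip0 X R => f x) \in @is_blin R (Lip0 X R) R.
Proof.
apply/is_blinP; split=> //; exists `|x| => f.
have /is_lip0P[_ f0] := valP f.
by rewrite mulrC -[f x]subr0 -[in leLHS]f0 -[x in leRHS]subr0 lip_norm_le.
Qed.

Definition delta (x : X) : dual (Lip0 X R) := MkBlin (eval_blin x).

Lemma restrict_blin (mu : dual (Lip0 X R)) :
  (fun f : Lip0ph X R => mu f) \in @is_blin R (Lip0ph X R) R.
Proof.
apply/is_blinP; split=> [a f g|]; first by rewrite -linearP.
by exists (op_norm mu) => f; exact: op_norm_le.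
Qed.

Definition restrict_ph (mu : dual (Lip0 X R)) : dual (Lip0ph X R) :=
  MkBlin (restrict_blin mu).

Definition delta_ph (x : X) : dual (Lip0ph X R) := restrict_ph (delta x).

Definition Free := ClosedSpan (range delta).
Definition Free_ph := ClosedSpan (range delta_ph).

Lemma delta_in (x : X) : delta x \in in_closed_span (range delta).
Proof. by rewrite inE; apply: sub_closed_span; exists x. Qed.

Lemma delta_ph_in (x : X) : delta_ph x \in in_closed_span (range delta_ph).
Proof. by rewrite inE; apply: sub_closed_span; exists x. Qed.

Definition deltaF (x : X) : Free := MkClosedSpan (delta_in x).
Definition deltaF_ph (x : X) : Free_ph := MkClosedSpan (delta_ph_in x).

Definition pairing (f : Lip0ph X R) (mu : Free_ph) : R := ClosedSpan_val mu f.

End Free.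

(* Main.v *)
Require Import Defs.
From HB Require Import structures.
From mathcomp Require Import all_boot all_order all_algebra.
From mathcomp Require Import all_classical all_reals ereal topology normedtype.
From mathcomp Require Import lra.

Import Order.TTheory GRing.Theory Num.Theory.
Import numFieldNormedType.Exports.

Local Open Scope classical_set_scope.
Local Open Scope ring_scope.

(* Everything rests on Hahn-Banach, obtained by taking a minimal sublinear
   functional p below the norm: lowering p to inf_(s >= 0) p (z + s v) - s p v
   keeps it sublinear, so minimality forces p (- v) = - p v. Norming functionals
   are positively homogeneous, which makes delta^ph isometric. A map f in
   Lip_0^ph(X, Y) acts by duality, C_f mu = (g |-> mu (g \o f)), and this sends
   delta^ph_x to delta^ph_(f x). When Y is complete, each mu in F^ph(Y) has a weak
   barycentre b mu in Y with phi (b mu) = mu phi for all phi in Y^*, and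
   T_f = b \o C_f. Uniqueness is density of the span of the delta^ph_x. *)

(** * Sublinear functionals and the Hahn-Banach theorem *)

Section HahnBanach.
Context (R : realType) (E : lmodType R).

Definition sublinear (p : E -> R) :=
  (forall x y, p (x + y) <= p x + p y) /\
  (forall a x, 0 <= a -> p (a *: x) = a * p x).

Lemma sublinear0 p : sublinear p -> p 0 = 0.
Proof. by case=> _ /(_ 0 0 (lexx 0)); rewrite scale0r mul0r. Qed.

Lemma sublinear_geN p x : sublinear p -> - p (- x) <= p x.
Proof.
move=> ps; have := ps.1 x (- x); rewrite subrr sublinear0//.
by rewrite -lerBlDr sub0r.
Qed.

(** The scalar [a^-1] at the point [a *: x] gives the reverse inequality. One-sided homogeneity is
    what comes easily for functionals defined as infima. *)
Lemma sublinear_le_homog p : (forall x y, p (x + y) <= p x + p y) -> p 0 = 0 ->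
  (forall a x, 0 < a -> p (a *: x) <= a * p x) -> sublinear p.
Proof.
move=> pD p0 pZ; split=> // a x; rewrite le_eqVlt => /predU1P[<-|a0].
  by rewrite scale0r mul0r.
apply/eqP; rewrite eq_le pZ//= -ler_pdivlMl//.
have := pZ a^-1 (a *: x); rewrite invr_gt0 => /(_ a0).
by rewrite scalerA mulVf ?scale1r// gt_eqF.
Qed.

(* [p] flattened in the direction [v]; for the norm this is a Busemann function. *)
Definition flatten_along (p : E -> R) (v z : E) : R :=
  inf [set p (z + s *: v) - s * p v | s in [set s | 0 <= s]].

Lemma flatten_along_ge p v z m :
  (forall s, 0 <= s -> m <= p (z + s *: v) - s * p v) ->
  m <= flatten_along p v z.
Proof.
move=> h; apply: lb_le_inf; last by move=> _ [s s0 <-]; exact: h.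
by exists (p (z + 0 *: v) - 0 * p v), 0 => //=.
Qed.

(** The infimum is over a set bounded below by [- p (- z)], since [s * p v = p (s *: v) <= p (z + s
    *: v) + p (- z)]. *)
Lemma flatten_along_le p v z s : sublinear p -> 0 <= s ->
  flatten_along p v z <= p (z + s *: v) - s * p v.
Proof.
move=> ps s0; apply: ge_inf; last by exists s.
exists (- p (- z)) => _ [t /= t0 <-].
rewrite -ps.2// lerBrDr addrC lerBlDr.
apply: le_trans (ps.1 _ _).
by rewrite addrAC subrr add0r.
Qed.

(** Parameters [s] for [x] and [t] for [y] combine to the competitor [s + t] for [x + y], and [s]
    for [x] yields the competitor [a * s] for [a *: x]. *)
Lemma flatten_along_sublinear p v : sublinear p -> sublinear (flatten_along p v).
Proof.
move=> ps; apply: sublinear_le_homog => [x y||a x a0].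
- rewrite -lerBlDr; apply: flatten_along_ge => s s0.
  rewrite lerBlDr -lerBlDl; apply: flatten_along_ge => t t0.
  rewrite lerBlDl.
  apply: le_trans (flatten_along_le p v _ _ ps (addr_ge0 s0 t0)) _.
  rewrite scalerDl mulrDl addrACA.
  have := ps.1 (x + s *: v) (y + t *: v); lra.
- apply/eqP; rewrite eq_le; apply/andP; split.
    apply: le_trans (flatten_along_le p v _ _ ps (lexx 0)) _.
    by rewrite scale0r mul0r addr0 subr0 sublinear0.
  by apply: flatten_along_ge => s s0; rewrite add0r ps.2// subrr.
- rewrite -ler_pdivrMl//; apply: flatten_along_ge => s s0.
  rewrite ler_pdivrMl//.
  have as0 : 0 <= a * s by rewrite mulr_ge0// ltW.
  apply: le_trans (flatten_along_le p v _ _ ps as0) _.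
  by rewrite -scalerA -scalerDr (ps.2 _ _ (ltW a0)) mulrBr mulrA.
Qed.

Lemma flatten_along_le_id p v z : sublinear p -> flatten_along p v z <= p z.
Proof.
move=> ps; apply: le_trans (flatten_along_le p v _ _ ps (lexx 0)) _.
by rewrite scale0r mul0r addr0 subr0.
Qed.

(** The parameter [s = 1] moves [- v] to the origin, which leaves only [- p v]. *)
Lemma flatten_alongN p v : sublinear p -> flatten_along p v (- v) <= - p v.
Proof.
move=> ps; apply: le_trans (flatten_along_le p v _ _ ps ler01) _.
by rewrite scale1r mul1r addNr sublinear0// sub0r.
Qed.

(** Zorn's lemma, where the pointwise infimum of a nonempty chain is again sublinear. *)
Lemma exists_minimal_sublinear q : sublinear q ->
  exists p, [/\ sublinear p, forall x, p x <= q x &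
    forall p', sublinear p' -> (forall x, p' x <= p x) -> p' = p].
Proof.
move=> qs.
pose T := {p : E -> R | sublinear p /\ forall x, p x <= q x}.
(* The order is reversed, so that a maximal element for [r] is a minimal functional. *)
pose r (p1 p2 : T) := `[< forall x, sval p2 x <= sval p1 x >].
have [|p1 p2 p3|p1 p2|A tA|[p [ps pq]] pmin] := @Zorn T r.
- by move=> p; apply/asboolP.
- move=> /asboolP h1 /asboolP h2; apply/asboolP => x.
  exact: le_trans (h2 x) (h1 x).
- move=> /asboolP h1 /asboolP h2; apply: eq_sig_hprop => [p|].
    exact: Prop_irrelevance.
  by apply/funext => x; apply/eqP; rewrite eq_le h1 h2.
- have [->|/set0P[p0 Ap0]] := eqVneq A set0.
    by exists (exist _ q (conj qs (fun x => lexx _))).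
  pose m x := inf [set sval p x | p in A].
  have m_le p x : A p -> m x <= sval p x.
    move=> Ap; apply: ge_inf; last by exists p.
    (* Each member satisfies [p' x >= - p' (- x) >= - q (- x)], so the infimum is finite. *)
    exists (- q (- x)) => _ [[p' [p's p'q]] _ <-] /=.
    by apply: le_trans (sublinear_geN _ x p's); rewrite lerN2.
  have m_glb x c : (forall p, A p -> c <= sval p x) -> c <= m x.
    move=> h; apply: lb_le_inf; first by exists (sval p0 x), p0.
    by move=> _ [p Ap <-]; exact: h.
  have mq x : m x <= q x.
    exact: le_trans (m_le _ x Ap0) ((svalP p0).2 x).
  suff ms : sublinear m.
    exists (exist _ m (conj ms mq)) => p Ap; apply/asboolP => x.
    exact: m_le.
  apply: sublinear_le_homog => [x y||a x a0].
  + rewrite -lerBlDr; apply/m_glb => p1 A1.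
    rewrite lerBlDr -lerBlDl; apply/m_glb => p2 A2; rewrite lerBlDl.
    (* Subadditivity survives because the chain makes [p1] and [p2] comparable: the smaller of the
       two bounds [m (x + y)]. *)
    have [/asboolP h|/asboolP h] := tA _ _ A1 A2.
      apply: le_trans (m_le _ _ A2) (le_trans ((svalP p2).1.1 _ _) _).
      by rewrite lerD.
    apply: le_trans (m_le _ _ A1) (le_trans ((svalP p1).1.1 _ _) _).
    by rewrite lerD.
  + apply/eqP; rewrite eq_le; apply/andP; split.
      by rewrite -(sublinear0 _ (svalP p0).1) m_le.
    by apply/m_glb => p _; rewrite sublinear0//; exact: (svalP p).1.
  + rewrite -ler_pdivrMl//; apply/m_glb => p Ap; rewrite ler_pdivrMl//.
    by rewrite -((svalP p).1.2 _ _ (ltW a0)) m_le.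
- exists p; split=> // p' p's p'p.
  have p'q x : p' x <= q x by exact: le_trans (p'p x) (pq x).
  have /pmin/(congr1 sval)// : r (exist _ p (conj ps pq)) (exist _ p' (conj p's p'q)).
  by apply/asboolP.
Qed.

(* A sublinear functional that no flattening can lower is odd, hence linear. *)
Lemma exists_linear_below q : sublinear q ->
  exists2 p : E -> R, linear_for *%R p & forall x, p x <= q x.
Proof.
move=> /exists_minimal_sublinear[p [ps pq pmin]]; exists p => //.
have pN x : p (- x) = - p x.
  apply/eqP; rewrite eq_le; apply/andP; split.
    have := flatten_alongN _ x ps.
    rewrite (pmin _ (flatten_along_sublinear _ x ps))// => z.
    exact: flatten_along_le_id.
  by have := sublinear_geN p (- x) ps; rewrite opprK.
have pD x y : p (x + y) = p x + p y.
  apply/eqP; rewrite eq_le ps.1/=.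
  have := ps.1 (- x) (- y); rewrite -opprD !pN; lra.
move=> a x y; rewrite pD; congr (_ + _).
have [a0|/ltW a0] := leP 0 a; first exact: ps.2.
have na0 : 0 <= - a by rewrite oppr_ge0.
by rewrite -[a]opprK scaleNr pN (ps.2 _ _ na0) !mulNr.
Qed.

End HahnBanach.

(** * Norming functionals *)

Section Norming.
Context (R : realType) (E : normedModType R).

Lemma norm_sublinear : @sublinear R E (fun x => `|x|).
Proof.
split=> [x y|a x a0]; first exact: ler_normD.
by rewrite normrZ ger0_norm.
Qed.

(** Hahn-Banach is applied to the norm already flattened along [v], whose value at [- v] is at most
    [- |v|]. Oddness of the linear minorant then forces the value at [v] up to [|v|]. *)
Lemma norming_functional (v : E) :
  exists phi : dual E, phi v = `|v| /\ `|phi| <= 1.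
Proof.
have ns := norm_sublinear.
have [p pl pq] := exists_linear_below _ _ _ (flatten_along_sublinear _ _ _ v ns).
pose p' : {linear E -> R | *%R} := HB.pack p (GRing.isLinear.Build _ _ _ _ p pl).
have ple x : p x <= `|x|.
  by apply: le_trans (pq x) _; exact: flatten_along_le_id.
have pN x : p (- x) = - p x by exact: (raddfN p').
have pabs x : `|p x| <= `|x|.
  by rewrite ler_norml ple lerNl -pN -[in leRHS]normrN ple.
have pb : p \in @is_blin R E R.
  by apply/is_blinP; split=> //; exists 1 => x; rewrite mul1r.
exists (MkBlin pb); split=> /=; last first.
  by apply: op_norm_ub => // x; rewrite mul1r.
apply/eqP; rewrite eq_le ple/= -lerN2 -pN.
by apply: le_trans (pq _) _; exact: flatten_alongN.
Qed.

End Norming.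

(** * Composition of positively homogeneous Lipschitz maps, and bounded linear maps as such maps *)

Section Constructions.
Context {R : realType}.
Implicit Types X Y Z : normedModType R.

Lemma pos_homogeneous0 {X Y} (f : X -> Y) : pos_homogeneous f -> f 0 = 0.
Proof. by move=> /(_ 0 0 (lexx 0)); rewrite !scale0r. Qed.

Lemma Lip0phP {X Y} (f : Lip0ph X Y) : pos_homogeneous f.
Proof. by have := valP f; rewrite inE. Qed.

Lemma exists_Lip0ph {X Y} (f : X -> Y) (M : R) :
  (forall x y, `|f x - f y| <= M * `|x - y|) -> pos_homogeneous f ->
  exists F : Lip0ph X Y, Lip0_fun F = f.
Proof.
move=> fM fh.
have f0 : f \in @is_lip0 R X Y.
  by apply/is_lip0P; split; [exists M|exact: pos_homogeneous0].
have fph : MkLip0 f0 \in @is_ph R X Y by rewrite inE.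
by exists (MkLip0ph fph).
Qed.

Lemma Lip0ph_le {X Y} (f : Lip0ph X Y) x y :
  `|f x - f y| <= `|f| * `|x - y|.
Proof. exact: lip_norm_le. Qed.

Lemma comp_ph_subproof {X Y Z} (g : Lip0ph Y Z) (f : Lip0ph X Y) :
  exists F : Lip0ph X Z, Lip0_fun F = g \o f.
Proof.
apply: (@exists_Lip0ph _ _ _ (`|g| * `|f|)) => [x y|a x a0] /=.
  apply: le_trans (Lip0ph_le _ _ _) _.
  by rewrite -mulrA ler_wpM2l// Lip0ph_le.
by rewrite Lip0phP// Lip0phP.
Qed.

Definition comp_ph {X Y Z} (g : Lip0ph Y Z) (f : Lip0ph X Y) : Lip0ph X Z :=
  sval (cid (comp_ph_subproof g f)).

Lemma comp_phE {X Y Z} (g : Lip0ph Y Z) (f : Lip0ph X Y) x :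
  comp_ph g f x = g (f x).
Proof. by rewrite /comp_ph; case: cid => F /= ->. Qed.

Lemma comp_ph_norm {X Y Z} (g : Lip0ph Y Z) (f : Lip0ph X Y) :
  `|comp_ph g f| <= `|g| * `|f|.
Proof.
apply: lip_norm_ub => [|x y]; first by rewrite mulr_ge0.
rewrite !comp_phE; apply: le_trans (Lip0ph_le _ _ _) _.
by rewrite -mulrA ler_wpM2l// Lip0ph_le.
Qed.

Lemma Lip0ph_ext {X Y} (f g : Lip0ph X Y) : (forall x, f x = g x) -> f = g.
Proof. by move=> fg; apply/val_inj/val_inj/funext. Qed.

Lemma comp_ph_linearl {X Y Z} a (g h : Lip0ph Y Z) (f : Lip0ph X Y) :
  comp_ph (a *: g + h) f = a *: comp_ph g f + comp_ph h f.
Proof. by apply: Lip0ph_ext => x; rewrite !comp_phE /= !fctE !comp_phE. Qed.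

Lemma blin_ph_subproof {X Y} (T : blin X Y) :
  exists F : Lip0ph X Y, Lip0_fun F = T.
Proof.
apply: (@exists_Lip0ph _ _ _ `|T|) => [x y|a x _].
  by rewrite -linearB; exact: op_norm_le.
by rewrite linearZ.
Qed.

(** Through this inclusion the functionals of the dual become test functions for [Free_ph], which is
    how norming functionals enter the later estimates. *)
Definition blin_ph {X Y} (T : blin X Y) : Lip0ph X Y :=
  sval (cid (blin_ph_subproof T)).

Lemma blin_phE {X Y} (T : blin X Y) x : blin_ph T x = T x.
Proof. by rewrite /blin_ph; case: cid => F /= ->. Qed.

Lemma blin_ph_norm {X Y} (T : blin X Y) : `|blin_ph T| <= `|T|.
Proof.
apply: lip_norm_ub => [|x y]; first exact: normr_ge0.
by rewrite !blin_phE -linearB; exact: op_norm_le.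
Qed.

Lemma exists_blin {X Y} (T : X -> Y) (M : R) : linear T ->
  (forall x, `|T x| <= M * `|x|) -> exists S : blin X Y, blin_fun S = T.
Proof.
move=> lT TM; have Tb : T \in @is_blin R X Y by apply/is_blinP; split=> //; exists M.
by exists (MkBlin Tb).
Qed.

Lemma blin_ext {X Y} (S T : blin X Y) : (forall x, S x = T x) -> S = T.
Proof. by move=> ST; apply/val_inj/funext. Qed.

Lemma blinB {X Y} (T : blin X Y) x y : T (x - y) = T x - T y.
Proof. exact: linearB. Qed.

Lemma blinZ {X Y} (T : blin X Y) a x : T (a *: x) = a *: T x.
Proof. exact: linearZ. Qed.

Lemma blin_comb {X Y} (T : blin X Y) I (s : seq I) (a : I -> R) (v : I -> X) :
  T (\sum_(i <- s) a i *: v i) = \sum_(i <- s) a i *: T (v i).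
Proof. by rewrite linear_sum; apply: eq_bigr => i _; exact: blinZ. Qed.

End Constructions.

(** * The pairing, and density of the combinations of point evaluations *)

Section FreePh.
Context {R : realType}.
Implicit Types X Y Z : normedModType R.

Lemma pairing_delta {X} (f : Lip0ph X R) x : pairing f (deltaF_ph x) = f x.
Proof. by []. Qed.

Lemma pairing_linearl {X} (mu : Free_ph X) a f g :
  pairing (a *: f + g) mu = a * pairing f mu + pairing g mu.
Proof. exact: (blin_linear (ClosedSpan_val mu)). Qed.

(** The set [A] is arbitrary because both [Free] and [Free_ph] are treated this way. *)
Lemma span_eval_linear {X} (A : set (dual X)) (f : X) a (mu nu : ClosedSpan A) :
  ClosedSpan_val (a *: mu + nu) f
  = a * ClosedSpan_val mu f + ClosedSpan_val nu f.
Proof. by rewrite ClosedSpan_val_linear. Qed.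

Lemma span_evalZ {X} (A : set (dual X)) (f : X) a (mu : ClosedSpan A) :
  ClosedSpan_val (a *: mu) f = a * ClosedSpan_val mu f.
Proof.
have z : ClosedSpan_val (0 : ClosedSpan A) f = 0.
  by have := span_eval_linear A f 1 0 0; rewrite scaler0 addr0; lra.
by have := span_eval_linear A f a mu 0; rewrite z !addr0.
Qed.

Lemma pairing_linearr {X} (f : Lip0ph X R) a (mu nu : Free_ph X) :
  pairing f (a *: mu + nu) = a * pairing f mu + pairing f nu.
Proof. exact: span_eval_linear. Qed.

Lemma pairingB {X} (f : Lip0ph X R) (mu nu : Free_ph X) :
  pairing f (mu - nu) = pairing f mu - pairing f nu.
Proof. by rewrite -scaleN1r addrC pairing_linearr mulN1r addrC. Qed.

Lemma pairingZ {X} (f : Lip0ph X R) a (mu : Free_ph X) :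
  pairing f (a *: mu) = a * pairing f mu.
Proof. exact: span_evalZ. Qed.

Lemma pairing_sum {X} (f : Lip0ph X R) (s : seq (R * X)) :
  pairing f (\sum_(p <- s) p.1 *: deltaF_ph p.2) = \sum_(p <- s) p.1 * f p.2.
Proof.
elim: s => [|p s IH]; first by rewrite !big_nil.
by rewrite !big_cons pairing_linearr IH.
Qed.

Lemma pairing_le {X} (f : Lip0ph X R) (mu : Free_ph X) :
  `|pairing f mu| <= `|mu| * `|f|.
Proof. exact: op_norm_le. Qed.

Lemma Free_ph_ext {X} (mu nu : Free_ph X) :
  (forall f, pairing f mu = pairing f nu) -> mu = nu.
Proof. by move=> h; apply/val_inj/blin_ext. Qed.

Lemma Free_ph_dense {X} (mu : Free_ph X) (e : R) : 0 < e ->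
  exists s : seq (R * X), `|mu - \sum_(p <- s) p.1 *: deltaF_ph p.2| < e.
Proof.
move=> e0; have := valP mu; rewrite inE => /closed_spanP/(_ e e0)[u [s [sA ->]]].
(* The approximating combination lives in the dual; it is rebuilt term by term inside [Free_ph]. *)
suff [t ->] : exists t : seq (R * X), \sum_(p <- s) p.1 *: p.2 =
    ClosedSpan_val (\sum_(p <- t) p.1 *: deltaF_ph p.2 : Free_ph X).
  by exists t.
elim: s sA => [|[a v] s IH] sA; first by exists [::]; rewrite !big_nil.
have [|t st] := IH; first by move=> p ps; apply: sA; rewrite inE ps orbT.
have [|x _ /= xv] := sA (a, v); first by rewrite mem_head.
by exists ((a, x) :: t); rewrite !big_cons st /= -xv.
Qed.

(** [D] kills every combination [u] of point evaluations, so [|D mu| = |D (mu - u)|], which density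
    makes arbitrarily small. *)
Lemma blin_free0 {X Y} (D : blin (Free_ph X) Y) mu :
  (forall x, D (deltaF_ph x) = 0) -> D mu = 0.
Proof.
move=> D0; apply/eqP; rewrite -normr_le0.
apply/ler_addgt0Pr => e e0; rewrite add0r.
(* Adding 1 keeps the divisor positive even when [D] is zero. *)
have D1 : 0 < `|D| + 1 by rewrite ltr_wpDl.
have [s smu] := Free_ph_dense mu _ (divr_gt0 e0 D1).
set u := \sum_(p <- s) _ in smu.
have Du : D u = 0.
  by rewrite blin_comb big1// => p _; rewrite D0 scaler0.
have -> : D mu = D (mu - u) by rewrite blinB Du subr0.
apply: le_trans (op_norm_le _ _) _; move: smu; rewrite ltr_pdivlMr// => smu.
by apply: le_trans (ltW smu); rewrite mulrC ler_wpM2l// lerDl.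
Qed.

(** Reduces uniqueness of [C_f], as well as linearity and invertibility of the map sending [f] to
    [T_f], to evaluation at the points [deltaF_ph x]. *)
Lemma blin_free_ext {X Y} (S T : blin (Free_ph X) Y) :
  (forall x, S (deltaF_ph x) = T (deltaF_ph x)) -> S = T.
Proof.
move=> ST; apply: blin_ext => mu; apply/eqP; rewrite -subr_eq0; apply/eqP.
apply: (blin_free0 (S - T)) => x.
by rewrite /= !fctE ST subrr.
Qed.

(** * Functoriality of [Free_ph] and linearization of Lipschitz maps *)

Lemma free_map_subproof {X Y} (f : Lip0ph X Y) (mu : Free_ph X) :
  exists nu : Free_ph Y, forall g, pairing g nu = pairing (comp_ph g f) mu.
Proof.
(* The adjoint of precomposition with [f] is first formed in the full dual of [Lip0ph Y R];
   membership in the closed span comes afterwards. *)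
have adj (m : Free_ph X) : exists n : dual (Lip0ph Y R),
    forall g, n g = pairing (comp_ph g f) m.
  have [||n nE] := @exists_blin R (Lip0ph Y R) R
    (fun g => pairing (comp_ph g f) m) (`|m| * `|f|).
  - by move=> a g h; rewrite comp_ph_linearl pairing_linearl.
  - move=> g; apply: le_trans (pairing_le _ _) _.
    by rewrite -mulrA ler_wpM2l// mulrC comp_ph_norm.
  by exists n => g; rewrite nE.
have [n nE] := adj mu.
suff nA : n \in in_closed_span (range (@delta_ph R Y)).
  by exists (MkClosedSpan nA).
rewrite inE; apply/closed_spanP => e e0.
have f1 : 0 < `|f| + 1 by rewrite ltr_wpDl.
have [s smu] := Free_ph_dense mu _ (divr_gt0 e0 f1).
(* The adjoint carries an approximant of [mu] to this combination and expands distances by a factor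
   of at most [|f|]. *)
exists (\sum_(p <- s) p.1 *: delta_ph (f p.2)).
  exists [seq (p.1, delta_ph (f p.2)) | p <- s]; split.
    by move=> _ /mapP[p ps ->]; exists (f p.2).
  by rewrite big_map.
set v := \sum_(p <- s) _.
have vE g : v g = \sum_(p <- s) p.1 * g (f p.2).
  rewrite /v; elim: s {smu v} => [|p s IH]; first by rewrite !big_nil.
  by rewrite !big_cons /= !fctE IH.
move: smu; rewrite ltr_pdivlMr//; apply: le_lt_trans.
apply: (@le_trans _ _ (`|mu - \sum_(p <- s) p.1 *: deltaF_ph p.2| * `|f|)); last first.
  by rewrite ler_wpM2l// lerDl.
apply: op_norm_ub => [|g]; first by rewrite mulr_ge0.
have -> : (n - v) g = pairing (comp_ph g f) (mu - \sum_(p <- s) p.1 *: deltaF_ph p.2).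
  rewrite pairingB pairing_sum /= !fctE nE vE; congr (_ - _).
  by apply: eq_bigr => p _; rewrite comp_phE.
apply: le_trans (pairing_le _ _) _.
by rewrite -mulrA ler_wpM2l// mulrC comp_ph_norm.
Qed.

Lemma exists_free_map {X Y} (f : Lip0ph X Y) :
  exists C : blin (Free_ph X) (Free_ph Y),
    (forall mu g, pairing g (C mu) = pairing (comp_ph g f) mu) /\
    (forall x, C (deltaF_ph x) = deltaF_ph (f x)).
Proof.
pose C mu := sval (cid (free_map_subproof f mu)).
have CE mu g : pairing g (C mu) = pairing (comp_ph g f) mu.
  by rewrite /C; case: cid.
have [||S SE] := @exists_blin R (Free_ph X) (Free_ph Y) C `|f|.
- move=> a mu nu; apply: Free_ph_ext => g.
  by rewrite CE !pairing_linearr !CE.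
- move=> mu; apply: op_norm_ub => [|g]; first by rewrite mulr_ge0.
  rewrite -/(pairing g (C mu)) CE; apply: le_trans (pairing_le _ _) _.
  by rewrite [`|f| * _]mulrC -mulrA ler_wpM2l// mulrC comp_ph_norm.
- exists S; rewrite SE; split=> // x; apply: Free_ph_ext => g.
  by rewrite CE !pairing_delta comp_phE.
Qed.

(* The limit exists because norming functionals turn approximations of [mu] by
   combinations of [deltaF_ph] into a Cauchy sequence of combinations in [Y]. *)
Lemma exists_barycentre {Y : completeNormedModType R} (mu : Free_ph Y) :
  exists y : Y, forall phi : dual Y, phi y = pairing (blin_ph phi) mu.
Proof.
have [s sP] := choice (fun n : nat =>
  Free_ph_dense mu n.+1%:R^-1 (ltac:(by rewrite invr_gt0 ltr0n))).
pose u n : Free_ph Y := \sum_(p <- s n) p.1 *: deltaF_ph p.2.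
pose y n := \sum_(p <- s n) p.1 *: p.2.
have yu n (phi : dual Y) : phi (y n) = pairing (blin_ph phi) (u n).
  rewrite pairing_sum blin_comb; apply: eq_bigr => p _.
  by rewrite blin_phE.
have small (e : R) : 0 < e -> \forall n \near \oo, `|mu - u n| < e.
  move=> e0; near=> n; apply: lt_trans (sP n) _.
  by near: n; exact: near_infty_natSinv_lt (PosNum e0).
have yB m n : `|y m - y n| <= `|u m - u n|.
  have [phi [<- phi1]] := norming_functional _ _ (y m - y n).
  rewrite blinB !yu -pairingB; apply: le_trans (ler_norm _) _.
  apply: le_trans (pairing_le _ _) _.
  rewrite -[leRHS]mulr1 ler_wpM2l//; exact: le_trans (blin_ph_norm _) _.
have /cvg_ex[z yz] : cvg (y @ \oo).
  apply: cauchy_cvg; apply: cauchy_exP => e e0.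
  have e20 : 0 < e / 2 by rewrite divr_gt0.
  have [N _ Ne] := small _ e20.
  exists (y N); rewrite -ball_normE.
  suff : \forall n \near \oo, `|y N - y n| < e by [].
  near=> n; apply: le_lt_trans (yB _ _) _.
  rewrite [ltRHS](splitr e) -(subrKA mu) (le_lt_trans (ler_normD _ _))//.
  rewrite ltrD//; last by near: n; exact: small.
  by rewrite distrC; exact: Ne (leqnn N).
exists z => phi; apply/eqP; rewrite -subr_eq0 -normr_le0.
apply/ler_addgt0Pr => e e0; rewrite add0r.
(* With error [d] in both [z] and [mu], the total is [|phi| * d + d * |blin_ph phi|]; the 1 makes
   the divisor positive. *)
have p1 : 0 < `|phi| + `|blin_ph phi| + 1 by rewrite ltr_wpDl// addr_ge0.
have d0 := divr_gt0 e0 p1; set d := e / _ in d0.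
have := small _ d0; move/cvgrPdist_lt : yz => /(_ d d0) yzd smalld.
near \oo => n.
(* By [yu] the identity holds exactly at the approximants, so these cancel and only the two errors
   remain. *)
have -> : phi z - pairing (blin_ph phi) mu
   = phi (z - y n) - pairing (blin_ph phi) (mu - u n).
  by rewrite blinB pairingB yu; lra.
apply: le_trans (ler_normB _ _) _.
apply: (@le_trans _ _ (`|phi| * d + d * `|blin_ph phi|)).
  rewrite lerD//.
    apply: le_trans (op_norm_le _ _) _; rewrite ler_wpM2l ?op_norm_ge0// ltW//.
    by near: n.
  apply: le_trans (pairing_le _ _) _; rewrite ler_wpM2r// ltW//.
  by near: n.
rewrite [d * _]mulrC -mulrDl -[leRHS](divfK (lt0r_neq0 p1)) -/d mulrC.
by rewrite ler_wpM2l ?(ltW d0)// lerDl.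
Unshelve. all: by end_near. Qed.

(** The barycentre map [b] is a mere choice function, so linearity of [T] is checked weakly:
    functionals separate the points of [Y], and each [phi (T mu)] is a pairing with [mu]. A
    functional norming [T mu] gives the bound. *)
Lemma exists_linearization {X} {Y : completeNormedModType R} (f : Lip0ph X Y) :
  exists T : blin (Free_ph X) Y,
    (forall x, T (deltaF_ph x) = f x) /\ `|T| <= `|f|.
Proof.
have sep (y z : Y) : (forall phi : dual Y, phi y = phi z) -> y = z.
  move=> yz; have [phi [h _]] := norming_functional _ _ (y - z).
  by apply/eqP; rewrite -subr_eq0 -normr_eq0 -h blinB yz subrr.
have [C [CE Cd]] := exists_free_map f.
have [b bE] := choice (@exists_barycentre Y).
pose T mu := b (C mu).
have TE (phi : dual Y) mu : phi (T mu) = pairing (comp_ph (blin_ph phi) f) mu.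
  by rewrite bE CE.
have TM mu : `|T mu| <= `|f| * `|mu|.
  have [phi [<- phi1]] := norming_functional _ _ (T mu).
  rewrite TE; apply: le_trans (ler_norm _) _; apply: le_trans (pairing_le _ _) _.
  rewrite mulrC ler_wpM2r//; apply: le_trans (comp_ph_norm _ _) _.
  rewrite -[leRHS]mul1r ler_wpM2r//; exact: le_trans (blin_ph_norm _) _.
have [|S SE] := @exists_blin R (Free_ph X) Y T `|f| _ TM.
- move=> a mu nu; apply: sep => phi.
  by rewrite (blin_linear phi) !TE pairing_linearr.
- exists S; split=> [x|].
    by rewrite SE; apply: sep => phi; rewrite TE pairing_delta comp_phE blin_phE.
  by apply: op_norm_ub => // mu; rewrite SE.
Qed.

(** * Isometry and homogeneity of the two embeddings *)

Lemma norming_Lip0ph {X} (x y : X) :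
  exists g : Lip0ph X R, g x - g y = `|x - y| /\ `|g| <= 1.
Proof.
have [phi [<- phi1]] := norming_functional _ _ (x - y).
exists (blin_ph phi); rewrite !blin_phE blinB; split=> //.
exact: le_trans (blin_ph_norm _) _.
Qed.

(** The lower bound tests against a norming functional of [x - y]. Being linear, it belongs to
    [Lip0ph], so the same witness serves [delta_ph_dist]. *)
Lemma delta_dist {X} (x y : X) : `|deltaF x - deltaF y| = `|x - y|.
Proof.
apply/eqP; rewrite eq_le; apply/andP; split.
  by apply: op_norm_ub => // f; rewrite mulrC; exact: lip_norm_le.
have [g [<- g1]] := norming_Lip0ph x y.
have -> : g x - g y = (delta x - delta y) g by [].
apply: le_trans (ler_norm _) _; apply: le_trans (op_norm_le _ _) _.
by rewrite -[leRHS]mulr1 ler_wpM2l ?op_norm_ge0.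
Qed.

Lemma delta_ph_dist {X} (x y : X) : `|deltaF_ph x - deltaF_ph y| = `|x - y|.
Proof.
apply/eqP; rewrite eq_le; apply/andP; split.
  by apply: op_norm_ub => // f; rewrite mulrC; exact: lip_norm_le.
have [g [<- g1]] := norming_Lip0ph x y.
rewrite -!pairing_delta -pairingB.
apply: le_trans (ler_norm _) _; apply: le_trans (pairing_le _ _) _.
by rewrite -[leRHS]mulr1 ler_wpM2l.
Qed.

Lemma delta_ph_homogeneous X : pos_homogeneous (@deltaF_ph R X).
Proof.
move=> a x a0; apply: Free_ph_ext => f.
rewrite pairingZ !pairing_delta; exact: Lip0phP.
Qed.

(** A nonlinear test function: it is even, whereas linearity of either embedding would make every
    test function odd. *)
Lemma exists_norm_ph X : exists g : Lip0ph X R, forall x, g x = `|x|.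
Proof.
have [||g gE] := @exists_Lip0ph R X R (fun x => `|x|) 1.
- by move=> x y; rewrite mul1r; exact: ler_dist_dist.
- by move=> a x a0; rewrite normrZ ger0_norm.
- by exists g => x; rewrite gE.
Qed.

Lemma delta_not_linear X (x : X) : x != 0 -> ~ linear (@deltaF R X).
Proof.
move=> x0 /(_ (-1) x 0) h; have [g gE] := exists_norm_ph X.
have := span_eval_linear _ (Lip0ph_val g) (-1) (deltaF x) (deltaF 0).
rewrite -h /= !gE normr0 !addr0 scaleN1r normrN.
have := normr_gt0 x; rewrite x0; lra.
Qed.

Lemma delta_ph_not_linear X (x : X) : x != 0 -> ~ linear (@deltaF_ph R X).
Proof.
move=> x0 /(_ (-1) x 0) h; have [g gE] := exists_norm_ph X.
have := pairing_linearr g (-1) (deltaF_ph x) (deltaF_ph 0).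
rewrite -h !pairing_delta !gE normr0 !addr0 scaleN1r normrN.
have := normr_gt0 x; rewrite x0; lra.
Qed.

(** Truncation at [c] is 1-Lipschitz and destroys homogeneity: with [c = |x|] the values at [x] and
    [2 *: x] coincide, which refutes homogeneity of [deltaF]. *)
Lemma exists_truncated_norm X (c : R) : 0 <= c ->
  exists g : Lip0 X R, forall x, g x = Num.min `|x| c.
Proof.
move=> c0; have gP : (fun x : X => Num.min `|x| c) \in @is_lip0 R X R.
  apply/is_lip0P; split; last by rewrite normr0; exact/min_idPl.
  exists 1 => x y; rewrite mul1r; apply: le_trans (ler_dist_dist x y).
  case: (leP `|x| c); case: (leP `|y| c) => hy hx //.
  - by rewrite ler0_norm ?ler0_norm; lra.
  - by rewrite ger0_norm ?ger0_norm; lra.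
  - by rewrite subrr normr0.
by exists (MkLip0 gP).
Qed.

Lemma delta_not_homogeneous X (x : X) : x != 0 -> ~ pos_homogeneous (@deltaF R X).
Proof.
move=> x0 /(_ 2 x (ler0n _ _)) h.
have [g gE] := exists_truncated_norm X _ (normr_ge0 x).
have := span_evalZ _ g 2 (deltaF x).
rewrite -h /= !gE normrZ ger0_norm// minxx.
have := normr_gt0 x; rewrite x0 => xp.
have -> : Num.min (2 * `|x|) `|x| = `|x| by apply/min_idPr; lra.
lra.
Qed.

(** * Duality formulas for the norms, and the isometric isomorphism *)

Lemma ereal_sup_op_norm {X Y} (T : blin X Y) :
  ereal_sup [set `|T x|%:E | x in @unit_ball R X] = (op_norm T)%:E.
Proof.
(* The real [sup] falls back to a default value on empty or unbounded sets, so its agreement with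
   [ereal_sup] rests on these two facts. *)
have [ne ub] := has_sup_blin T.
by rewrite /op_norm -ereal_sup_EFin// image_comp.
Qed.

(** Pairing with [f] is a bounded functional on [Free_ph X]. Its norm is at least the Lipschitz
    constant, as seen on the differences [deltaF_ph x - deltaF_ph y], whose norm is [|x - y|]. *)
Lemma ereal_sup_pairingr {X} (f : Lip0ph X R) :
  ereal_sup [set `|pairing f mu|%:E | mu in @unit_ball R (Free_ph X)]
  = (lip_norm f)%:E.
Proof.
have [||T TE] := @exists_blin R (Free_ph X) R (pairing f) `|f|.
- by move=> a mu nu; exact: pairing_linearr.
- by move=> mu; rewrite mulrC pairing_le.
rewrite -TE ereal_sup_op_norm; congr EFin; apply/eqP; rewrite eq_le.
apply/andP; split.
  apply: op_norm_ub => [|mu]; first exact: lip_norm_ge0.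
  by rewrite TE mulrC; exact: pairing_le.
apply: lip_norm_ub => [|x y]; first exact: op_norm_ge0.
rewrite -!pairing_delta -pairingB -TE -delta_ph_dist.
exact: op_norm_le.
Qed.

Lemma linearization_norm {X Y} (f : Lip0ph X Y) (T : blin (Free_ph X) Y) :
  (forall x, T (deltaF_ph x) = f x) -> `|f| <= `|T|.
Proof.
move=> Tf; apply: lip_norm_ub => // x y.
by rewrite -!Tf -blinB -delta_ph_dist; exact: op_norm_le.
Qed.

Lemma linearization_isomorphism X (Y : completeNormedModType R) :
  exists Phi : {linear Lip0ph X Y -> blin (Free_ph X) Y},
     [/\ forall f : Lip0ph X Y, Phi f \o @deltaF_ph R X = f,
         forall f : Lip0ph X Y, `|Phi f| = `|f|
       & bijective Phi].
Proof.
have [P PP] := choice (@exists_linearization X Y).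
have Pd f x : P f (deltaF_ph x) = f x by exact: (PP f).1.
have Plin : linear P.
  move=> a f g; apply: blin_free_ext => x.
  by rewrite /= !fctE !Pd.
(* The inverse is precomposition with [deltaF_ph], which is isometric and positively homogeneous. *)
have QP (T : blin (Free_ph X) Y) : exists f : Lip0ph X Y,
    forall x, f x = T (deltaF_ph x).
  have [||f fE] := @exists_Lip0ph R X Y (T \o @deltaF_ph R X) `|T|.
  - by move=> x y /=; rewrite -blinB -delta_ph_dist; exact: op_norm_le.
  - by move=> a x a0 /=; rewrite delta_ph_homogeneous// blinZ.
  - by exists f => x; rewrite fE.
have [Q QE] := choice QP.
pose Phi : {linear Lip0ph X Y -> blin (Free_ph X) Y} :=
  HB.pack P (GRing.isLinear.Build _ _ _ _ P Plin).
exists Phi; split=> [f|f|] /=.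
- by apply/funext => x /=; exact: Pd.
- by apply/eqP; rewrite eq_le (PP f).2 linearization_norm.
- exists Q => [f|T]; first by apply: Lip0ph_ext => x; rewrite QE Pd.
  by apply: blin_free_ext => x; rewrite Pd QE.
Qed.

End FreePh.
Theorem mainTheorem4 (R : realType) (X Y : completeNormedModType R) :
  (* (1) *)
  (submod_closed (in_closed_span (range (@delta_ph R X))) /\
   closed (closed_span (range (@delta_ph R X)))) /\
  (* (2) *)
  ((forall x y : X, `|deltaF x - deltaF y| = `|x - y|) /\
   (forall x y : X, `|deltaF_ph x - deltaF_ph y| = `|x - y|) /\
   ((exists x : X, x != 0) ->
      ~ linear (@deltaF R X) /\ ~ linear (@deltaF_ph R X))) /\
  (* (3) *)
  (pos_homogeneous (@deltaF_ph R X) /\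
   ((exists x : X, x != 0) -> ~ pos_homogeneous (@deltaF R X))) /\
  (* (4) *)
  (bilinear_for *%R *%R (@pairing R X) /\
   (forall f : Lip0ph X R, (forall mu : Free_ph X, pairing f mu = 0) -> f = 0) /\
   (forall mu : Free_ph X, (forall f : Lip0ph X R, pairing f mu = 0) -> mu = 0) /\
   (forall mu : Free_ph X,
      ereal_sup [set `|pairing f mu|%:E | f in @unit_ball R (Lip0ph X R)]
      = `|mu|%:E) /\
   (forall f : Lip0ph X R,
      ereal_sup [set `|pairing f mu|%:E | mu in @unit_ball R (Free_ph X)]
      = (lip_norm f)%:E)) /\
  (* (5) *)
  (exists Phi : {linear Lip0ph X Y -> blin (Free_ph X) Y},
     [/\ forall f : Lip0ph X Y, Phi f \o @deltaF_ph R X = f,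
         forall f : Lip0ph X Y, `|Phi f| = `|f|
       & bijective Phi]) /\
  (* (6) *)
  (forall f : Lip0ph X Y,
     exists! C : blin (Free_ph X) (Free_ph Y),
       C \o @deltaF_ph R X = @deltaF_ph R Y \o f).
Proof.
split; first by split; [exact: in_closed_span_submod_closed|exact: closed_closure].
split.
  split; [exact: delta_dist|split; [exact: delta_ph_dist|]].
  move=> [x x0]; split; [exact: delta_not_linear x0|exact: delta_ph_not_linear x0].
split.
  split; first exact: delta_ph_homogeneous.
  by move=> [x x0]; exact: delta_not_homogeneous x0.
split.
  split; first by split=> [mu a f g|f a mu nu];
    [exact: pairing_linearl|exact: pairing_linearr].
  split.
    by move=> f f0; apply: Lip0ph_ext => x; rewrite -pairing_delta f0.
  split.
    move=> mu mu0; apply: Free_ph_ext => f; rewrite mu0.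
    by rewrite -(scale0r mu) pairingZ mul0r.
  split; last exact: ereal_sup_pairingr.
  (* The norm of [Free_ph X] is inherited from the dual, so it is the operator norm of the
     functional underlying [mu]. *)
  by move=> mu; exact: ereal_sup_op_norm.
split; first exact: linearization_isomorphism.
move=> f; have [C [_ Cd]] := exists_free_map f.
exists C; split; first by apply/funext => x; exact: Cd.
move=> D DE; apply: blin_free_ext => x; rewrite Cd.
by rewrite -[RHS]/((D \o @deltaF_ph R X) x) DE.
Qed.
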